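(* Let $\Lambda$ be a real interval, $X$ a separable Fréchet space and $(T(\lambda))_{\lambda \in \Lambda}$ a continuous family of operators on $X$. Suppose that for any compact subinterval $K$ of $\Lambda$, there exist some dense subset $X_0$ of $X$ and maps $S_n(\lambda) : X_0 \to X$, $n \geq 0$, $\lambda \in K$, such that for any $x \in X_0$: (i) the series $\sum_{n = 0}^{m} T^m(\lambda)(S_{m - n}(\mu_n)(x))$ converges unconditionally and uniformly for $m \geq 0$, $\mu_0 \geq \ldots \geq \mu_m$ in $K$ and $\lambda \in K$; (ii) the series $\sum_{n \geq 0} T^m(\lambda)(S_{m + n}(\mu_n)(x))$ converges unconditionally and uniformly for $m \geq 0$, $(\mu_n)_{n \geq 0}$ any non-decreasing sequence from $K$ and $\lambda \in K$ with $\lambda \leq \mu_0$; (iii) for any $\varepsilon > 0$, there exists some decreasing sequence $(d_n)_{n \geq 1}$ of positive numbers such that (a) for any $n \geq 1$ and any $\lambda, \mu \in K$, if $0 \leq \mu - \lambda \leq d_n$ then $\Vert T^n(\lambda)(S_n(\mu)(x)) - x \Vert \leq \varepsilon$; (b) for any $c \in \mathbb{N}$, the series $\sum_{t \geq 1} d_{c^t}$ diverges; (iv) $(T^n(\lambda)(x))_{n \geq 0}$ converges to $0$ uniformly for $\lambda \in K$. Then the set of common upper frequently hypercyclic vectors for $(T(\lambda))_{\lambda \in \Lambda}$ is residual in $X$, and in particular, non-empty.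
   Context: $\mathbb{N}$ denotes the positive integers and $\mathbb{N}_0$ the nonnegative integers. An operator on a Fréchet space $X$ is a continuous linear map $X \to X$; $T^m(\lambda)$ denotes the $m$-th iterate of $T(\lambda)$. A family of operators $(T(\lambda))_{\lambda \in \Lambda}$ indexed by a metric space $\Lambda$ is called continuous if for any $x \in X$ the map $\Lambda \to X : \lambda \mapsto T(\lambda)(x)$ is continuous on $\Lambda$. The maps $S_n(\lambda)$ are arbitrary maps (no linearity or continuity is assumed). The Fréchet space $X$ is endowed with a separating increasing sequence of seminorms $(p_k)_{k \geq 1}$ defining its topology, and $\Vert \cdot \Vert$ denotes the $F$-norm on $X$ given by $\Vert x \Vert := \sum_{k \geq 1} \frac{1}{2^k} \min(1, p_k(x))$, which induces the topology of $X$. Given an index set $I$ and a family $(x_{\iota, n})$ of vectors of $X$ indexed by $\iota \in I$ and $n$, the series $\sum_n x_{\iota, n}$ converges unconditionally and uniformly for $\iota \in I$ if for any $\varepsilon > 0$ there exists some $N_0 \in \mathbb{N}$ such that for any $\iota \in I$ and any finite set $F \subset \{N_0, N_0 + 1, \ldots\}$, $\Vert \sum_{n \in F} x_{\iota, n} \Vert < \varepsilon$. In (i) the finite sums are regarded as infinite series by adding $0$ terms (for $n > m$), the index $\iota$ ranging over all $(m, (\mu_0, \ldots, \mu_m), \lambda)$ as described; in (ii) $\iota$ ranges over all $(m, (\mu_n)_{n \geq 0}, \lambda)$ as described. The upper density of $A \subset \mathbb{N}_0$ is $\overline{\mathrm{dens}}(A) = \limsup_{n \to \infty} \frac{\#(A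 \cap [0,n])}{n+1}$. A vector $x \in X$ is upper frequently hypercyclic for an operator $T$ if for any non-empty open subset $U$ of $X$, $\overline{\mathrm{dens}}(\{ m \geq 0 \mid T^m(x) \in U \}) > 0$. A vector is a common upper frequently hypercyclic vector for $(T(\lambda))_{\lambda \in \Lambda}$ if it is upper frequently hypercyclic for $T(\lambda)$ for every $\lambda \in \Lambda$. A set is residual if it contains a countable intersection of dense open sets. *)

(* Defs.v *)
From HB Require Import structures.
From mathcomp Require Import all_boot all_order all_algebra.
From mathcomp Require Import finmap.
From mathcomp Require Import all_classical all_reals all_analysis.
From mathcomp.real_closed Require Import complex.

Set Implicit Arguments.
Unset Strict Implicit.
Unset Printing Implicit Defensive.
Import Order.TTheory GRing.Theory Num.Theory.
Import numFieldNormedType.Exports.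

Local Open Scope classical_set_scope.
Local Open Scope ring_scope.

(* Fréchet spaces may be real or complex. *)
Variant scalar_kind := RealScalars | ComplexScalars.

Definition scalars (R : realType) (s : scalar_kind) : numFieldType :=
  match s with RealScalars => R | ComplexScalars => R[i] end.

(* The norm of [R[i]] takes its values in [R[i]]; the modulus is its real part. *)
Definition modulus (R : realType) (s : scalar_kind) : scalars R s -> R :=
  match s with
  | RealScalars => fun a : R => `|a|
  | ComplexScalars => fun a : R[i] => complex.Re `|a|
  end.

Section Frechet.
Variables (R : realType) (s : scalar_kind) (X : tvsType (scalars R s)).
Implicit Types (p : nat -> X -> R).

Record seminorm (q : X -> R) : Prop := {
  seminorm_ge0 : forall x, 0 <= q x;
  seminormD : forall x y, q (x + y) <= q x + q y;
  seminormZ : forall (a : scalars R s) x, q (a *: x) = modulus a * q x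
}.

(* [p j] stands for the seminorm of index [j + 1]. As the sequence is
   increasing, the balls of the single seminorms form a base of the topology.
   Completeness is expressed by means of the seminorms because the uniformity
   carried by a [tvsType] is only required to be compatible with the topology,
   not with the addition. *)
Record frechet_seminorms p : Prop := {
  frechet_seminorm : forall j, seminorm (p j);
  frechet_increasing : forall j x, p j x <= p j.+1 x;
  frechet_separating : forall x, (forall j, p j x = 0) -> x = 0;
  frechet_topology : forall (x : X) (U : set X),
    nbhs x U <->
    exists j, exists2 e : R, 0 < e & [set y | p j (y - x) < e] `<=` U;
  frechet_complete : forall u : nat -> X,
    (forall j (e : R), 0 < e ->
       exists N, forall m n, (N <= m)%N -> (N <= n)%N -> p j (u m - u n) < e) ->
    exists l : X, u @ \oo --> l
}.

Definition Fnorm p (x : X) : R :=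
  limn (series (fun j => 2^-1 ^+ j.+1 * Num.min 1 (p j x))).

Definition unif_uncond_cvg p (I : Type) (D : set I) (u : I -> nat -> X) :=
  forall e : R, 0 < e -> exists N0 : nat,
    forall i, D i -> forall F : {fset nat},
      (forall n, n \in F -> (N0 <= n)%N) ->
      Fnorm p (\sum_(n <- F) u i n) < e.

Definition upper_density (A : set nat) : \bar R :=
  limn_esup (fun n => (#|` fset_set (A `&` `I_n.+1)|%:R / n.+1%:R)%:E).

Definition upper_freq_hypercyclic (f : X -> X) (x : X) :=
  forall U : set X, open U -> U !=set0 ->
    (0 < upper_density [set m | U (iter m f x)])%E.

Definition common_upper_freq_hypercyclic (L : set R) (T : R -> X -> X) : set X :=
  [set x | forall l, L l -> upper_freq_hypercyclic (T l) x].

End Frechet.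

Definition separable (X : topologicalType) :=
  exists D : set X, countable D /\ dense D.

Definition residual (X : topologicalType) (A : set X) :=
  exists2 U : nat -> set X,
    (forall n, open (U n) /\ dense (U n)) & \bigcap_n U n `<=` A.

Section Criterion.
Variables (R : realType) (s : scalar_kind) (X : tvsType (scalars R s)).
Variables (p : nat -> X -> R) (T : R -> X -> X).
Variables (K : set R) (S : nat -> R -> X -> X).

(* Only the values [mu 0, ..., mu m] of the sequence [mu] matter. *)
Definition backward_cvg (x : X) :=
  unif_uncond_cvg p
    [set i : nat * (nat -> R) * R | let: (m, mu, l) := i in
      [/\ forall n, (n <= m)%N -> K (mu n),
          forall n, (n < m)%N -> mu n.+1 <= mu n
        & K l]]
    (fun i n => let: (m, mu, l) := i in
      if (n <= m)%N then iter m (T l) (S (m - n) (mu n) x) else 0).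

Definition forward_cvg (x : X) :=
  unif_uncond_cvg p
    [set i : nat * (nat -> R) * R | let: (m, mu, l) := i in
      [/\ forall n, K (mu n),
          forall n, mu n <= mu n.+1,
          K l
        & l <= mu 0%N]]
    (fun i n => let: (m, mu, l) := i in
      iter m (T l) (S (m + n)%N (mu n) x)).

(* [d] is indexed from 1: the value [d 0] is irrelevant. It decreases in the wide
   sense; a nonincreasing [d] can be made strictly decreasing by passing to
   [d n * (1 + n^-1) / 2], which keeps both remaining conditions. *)
Definition approx_right_inverse (x : X) :=
  forall e : R, 0 < e -> exists d : nat -> R,
    [/\ forall n, (0 < n)%N -> 0 < d n,
        forall n, (0 < n)%N -> d n.+1 <= d n,
        forall n, (0 < n)%N -> forall l mu, K l -> K mu ->
          0 <= mu - l <= d n ->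
          Fnorm p (iter n (T l) (S n mu x) - x) <= e
      & forall c, (0 < c)%N -> ~ cvgn (series (fun t => d (c ^ t.+1)%N))].

Definition orbit_unif_cvg0 (x : X) :=
  forall e : R, 0 < e -> \forall n \near \oo, forall l, K l ->
    Fnorm p (iter n (T l) x) < e.

End Criterion.

(* Main.v *)
(** The residual set is an intersection of sets of vectors [x] such that, for
    every [l] in a compact interval [[a, b]], the orbit of [x] under [T l] visits
    a basic open set [U] with frequency at least [delta] up to some time [n >= N].
    By the Banach-Steinhaus theorem, [(l, x) |-> T l ^m x] is continuous on
    [[a, b] x X], so these sets are open. They are dense because, given [x] in [U]
    and [y] in [X0], one can take [z = y + sum_(n in A) S n (mu n) x], where [A]
    consists of the multiples of some [M] in the union of finitely many blocks
    [[c ^ t, c ^ t.+1)] with [c = 2 M], and [mu] is constant on each block and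
    grows by [d (c ^ t.+1)] from one block to the next. Since the series of these
    increments diverges, each [l] in [[a, b]] lies within [d (c ^ t.+1)] below the
    value of [mu] on some block; for the times [m] in [A] from that block, the
    [m]-th term of [z] is sent close to [x] by the [m]-th iterate of [T l], whereas
    (i), (ii) and (iv) make the images of the other terms and of [y] small. The
    frequency [(2 M)^-1] does not depend on [N]. *)

Require Import Defs.
From mathcomp Require Import finmap.
From mathcomp Require Import all_boot all_order all_algebra.
From mathcomp Require Import all_classical all_reals all_analysis.
From mathcomp.real_closed Require Import complex.
From mathcomp Require Import zify lra.
Import Order.TTheory GRing.Theory Num.Theory.
Import numFieldNormedType.Exports.

Set Implicit Arguments.
Unset Strict Implicit.
Unset Printing Implicit Defensive.

Local Open Scope classical_set_scope.
Local Open Scope ring_scope.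

(** * Covering a compact interval by the steps of a divergent series *)

(** Take [nu t] to be [a] plus the sum of [g] from [t0] to [t], capped at [b]; divergence makes it
    reach [b]. The first [t >= t0] with [l <= nu t] works: the previous value of [nu], or [a] if
    [t = t0], is at most [l]. *)
Lemma interval_cover (R : realType) (g : nat -> R) (a b : R) t0 :
  (forall t, 0 < g t) -> ~ cvgn (series g) -> a <= b ->
  exists nu : nat -> R, exists t1 : nat,
  [/\ forall t, a <= nu t <= b,
      forall t t', (t <= t')%N -> nu t <= nu t' &
      forall l, a <= l <= b ->
        exists t, [/\ (t0 <= t < t1)%N, l <= nu t & nu t - l <= g t]].
Proof.
move=> g0 g_div ab.
pose sg t := \sum_(t0 <= i < t.+1) g i.
have sgS t : (t0 <= t.+1)%N -> sg t.+1 = sg t + g t.+1.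
  by move=> t0t; rewrite /sg big_nat_recr.
have sg_ge0 t : 0 <= sg t by apply: sumr_ge0 => i _; exact: ltW.
have sg_mono t t' : (t <= t')%N -> sg t <= sg t'.
  move=> /subnK <-; elim: (t' - t)%N => [//|k IHk].
  rewrite addSn (le_trans IHk)//; have [t0t|tt0] := leqP t0 (k + t).+1.
    by rewrite sgS// lerDl ltW.
  by rewrite /sg !big_geq// ltnW.
have [t1 t1P] : exists t1, b - a <= sg t1.
  apply: contrapT => /forallNP sg_lt; apply: g_div.
  apply: nondecreasing_is_cvgn.
    by apply/nondecreasing_seqP => n; rewrite /series/= big_nat_recr//= lerDl ltW.
  exists (series g t0 + (b - a)) => _ [n _ <-].
  apply: (@le_trans _ _ (series g (maxn t0 n).+1)).
    rewrite /series/= (@big_cat_nat _ _ _ n 0 (maxn t0 n).+1)//=; last first.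
      by rewrite leqW// leq_maxr.
    by rewrite lerDl sumr_ge0// => i _; exact: ltW.
  rewrite /series/= (@big_cat_nat _ _ _ t0 0 (maxn t0 n).+1)//=; last first.
    by rewrite leqW// leq_maxl.
  by rewrite lerD2l; have /negP := sg_lt (maxn t0 n); rewrite -ltNge => /ltW.
pose nu t := Num.min b (a + sg t).
exists nu, (maxn t0 t1).+1; split.
- by move=> t; rewrite le_min ab lerDl sg_ge0/= ge_min lexx.
- move=> t t' tt'; rewrite le_min ge_min lexx/= ge_min.
  by rewrite lerD2l sg_mono ?orbT.
move=> l /andP[al lb].
have exP : exists t, (t0 <= t)%N && (l <= nu t).
  exists (maxn t0 t1); rewrite leq_maxl/= le_min lb/=.
  by have := sg_mono _ _ (leq_maxr t0 t1); lra.
exists (ex_minn exP); case: ex_minnP => t /andP[t0t lt] t_min; split => //.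
  rewrite t0t ltnS t_min// leq_maxl/= le_min lb/=.
  by have := sg_mono _ _ (leq_maxr t0 t1); lra.
have [t0E|t0_neq] := eqVneq t0 t.
  have -> : g t = sg t by rewrite /sg t0E big_nat1.
  have : nu t <= a + sg t by rewrite ge_min lexx orbT.
  by lra.
case: t t0t lt t_min t0_neq => [|t] t0t lt t_min t0_neq.
  by move: t0t t0_neq; rewrite leqn0 => ->.
have t0t' : (t0 <= t)%N by rewrite -ltnS ltn_neqAle t0_neq.
have : nu t < l.
  by rewrite ltNge; apply/negP => lt'; have := t_min t; rewrite t0t' lt' ltnn => /(_ isT).
have : nu t.+1 <= a + sg t.+1 by rewrite ge_min lexx orbT.
rewrite sgS// /nu gt_min ltNge lb/=; lra.
Qed.

(** * Scalars, seminorms and the F-norm *)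

Lemma modulus_nat (R : realType) (s : scalar_kind) n :
  modulus (n%:R : scalars R s) = n%:R.
Proof.
case: s => /=; first exact: (normr_nat R).
rewrite -[LHS]/(complex.Re `|n%:R : R[i]|) normr_nat.
by elim: n => [//|n IHn]; rewrite -!natr1 -IHn; case: (n%:R).
Qed.

Lemma modulusN1 (R : realType) (s : scalar_kind) :
  modulus (-1 : scalars R s) = 1.
Proof.
case: s => /=; first exact: (normrN1 R).
by rewrite -[LHS]/(complex.Re `|-1 : R[i]|) normrN1.
Qed.

Section FrechetSpace.
Variables (R : realType) (s : scalar_kind) (X : tvsType (scalars R s)).
Variable p : nat -> X -> R.
Hypothesis pP : frechet_seminorms p.
Implicit Types (x y z : X) (U V : set X).

Let pP' j : seminorm (p j) := frechet_seminorm pP j.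

Lemma seminorm0 j : p j 0 = 0.
Proof.
by rewrite -(scale0r (0 : X)) (seminormZ (pP' j)) (modulus_nat R s 0) mul0r.
Qed.

Lemma seminormN j x : p j (- x) = p j x.
Proof. by rewrite -scaleN1r (seminormZ (pP' j)) modulusN1 mul1r. Qed.

Lemma seminormB j x y : p j (x - y) = p j (y - x).
Proof. by rewrite -seminormN opprB. Qed.

Lemma seminormMn j x n : p j (x *+ n) = n%:R * p j x.
Proof. by rewrite -scaler_nat (seminormZ (pP' j)) modulus_nat. Qed.

Lemma seminorm_tri j y x z : p j (x - z) <= p j (x - y) + p j (y - z).
Proof.
have -> : x - z = (x - y) + (y - z) by rewrite addrA subrK.
exact: seminormD.
Qed.

Lemma seminorm_leq i j x : (i <= j)%N -> p i x <= p j x.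
Proof.
move=> /subnK <-; elim: (j - i)%N => [//|k IHk].
by rewrite addSn (le_trans IHk) ?(frechet_increasing pP).
Qed.

Lemma nbhs_seminorm_ball j x (e : R) : 0 < e ->
  nbhs x [set y | p j (y - x) < e].
Proof. by move=> e0; apply/(frechet_topology pP); exists j, e. Qed.

Lemma open_seminorm_ball j x (e : R) : open [set y | p j (y - x) < e].
Proof.
rewrite openE => y /= yx; apply/(frechet_topology pP); exists j, (e - p j (y - x)).
  by rewrite subr_gt0.
by move=> z /= zy; rewrite (le_lt_trans (seminorm_tri j y z x))// -ltrBrDr.
Qed.

Lemma open_seminorm_ballP U x : open U -> U x ->
  exists j, exists2 e : R, 0 < e & [set y | p j (y - x) < e] `<=` U.
Proof.
by move=> Uo Ux; apply/(frechet_topology pP); exact: open_nbhs_nbhs.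
Qed.

Let Fterm x j : R := 2^-1 ^+ j.+1 * Num.min 1 (p j x).

Let Fterm_ge0 x j : 0 <= Fterm x j.
Proof.
by rewrite mulr_ge0// ?exprn_ge0// le_min ler01/= (seminorm_ge0 (pP' j)).
Qed.

Let is_cvg_Fterm x : cvgn (series (Fterm x)).
Proof.
have half : `|2^-1 : R| < 1 by rewrite ger0_norm ?invr_ge0// invf_lt1// ltr1n.
apply: (series_le_cvg (v_ := geometric (2^-1 : R) 2^-1)) => //.
- by move=> j /=; rewrite mulr_ge0// exprn_ge0.
- by move=> j /=; rewrite /Fterm exprS ler_piMr ?mulr_ge0 ?exprn_ge0// ge_min lexx.
- exact: is_cvg_geometric_series.
Qed.

Lemma FnormD x y : Fnorm p (x + y) <= Fnorm p x + Fnorm p y.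
Proof.
rewrite /Fnorm -/(Fterm x) -/(Fterm y) -/(Fterm (x + y)).
have seriesD : series (Fterm x \+ Fterm y) = series (Fterm x) + series (Fterm y).
  by apply/funext => n; rewrite /series/= fctE big_split.
rewrite -limD// -seriesD; apply: lim_series_le => //.
  by rewrite seriesD; exact: is_cvgD.
move=> j; rewrite /Fterm /= -mulrDr ler_wpM2l ?exprn_ge0//.
have := seminormD (pP' j) x y.
have := seminorm_ge0 (pP' j) x; have := seminorm_ge0 (pP' j) y.
rewrite ge_min !minEle; case: ifP => _; case: ifP => _ *; apply/orP; lra.
Qed.

(** A term of a series of nonnegative terms is at most the sum, and [min 1 (p j x) < min 1 e] forces
    the left minimum to be [p j x]. *)
Lemma Fnorm_lt_seminorm j x (e : R) :
  Fnorm p x < 2^-1 ^+ j.+1 * Num.min 1 e -> p j x < e.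
Proof.
move=> xe; have : Fterm x j < 2^-1 ^+ j.+1 * Num.min 1 e.
  apply: le_lt_trans xe.
  have mono : {homo series (Fterm x) : m n / (m <= n)%N >-> m <= n}.
    by apply/nondecreasing_seqP => n; rewrite /series/= big_nat_recr//= lerDl.
  apply: le_trans (nondecreasing_cvgn_le mono (@is_cvg_Fterm x) j.+1).
  by rewrite /series/= big_nat_recr//= lerDr sumr_ge0.
rewrite /Fterm ltr_pM2l ?exprn_gt0 ?invr_gt0// lt_min !gt_min ltxx/=.
by move=> /andP[? /orP[|] ?]; lra.
Qed.

Lemma open_Fnorm_ballP U x : open U -> U x ->
  exists2 e : R, 0 < e & forall y, Fnorm p (y - x) < e -> U y.
Proof.
move=> Uo Ux; have [j [e e0 eU]] := open_seminorm_ballP Uo Ux.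
exists (2^-1 ^+ j.+1 * Num.min 1 e).
  by rewrite mulr_gt0 ?exprn_gt0// lt_min ltr01.
by move=> y /Fnorm_lt_seminorm; exact: eU.
Qed.

(** * The Baire category theorem *)

(** Balls are nested with radii tending to 0 and seminorm indices tending to infinity, so that the
    centres are Cauchy for every seminorm; their limit lies in all the closed balls. *)
Lemma frechet_baire (O : nat -> set X) :
  (forall n, open (O n) /\ dense (O n)) -> dense (\bigcap_n O n).
Proof.
move=> OP.
have step n V : open V -> V !=set0 -> exists x, exists j, exists e : R,
    [/\ (n <= j)%N, 0 < e, e <= n.+1%:R^-1 &
     [set y | p j (y - x) <= e] `<=` V `&` O n].
  move=> Vo V0; have [Oo Od] := OP n.
  have [x VOx] := Od _ V0 Vo.
  have [j [e e0 eV]] := open_seminorm_ballP (openI Vo Oo) VOx.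
  exists x, (maxn n j), (Num.min (e / 2) n.+1%:R^-1); split.
  - exact: leq_maxl.
  - by rewrite lt_min divr_gt0//= invr_gt0.
  - by rewrite ge_min lexx orbT.
  move=> y /= yx; apply: eV => /=; rewrite (le_lt_trans (seminorm_leq _ (leq_maxr n j)))//.
  by move: yx; rewrite le_min => /andP[? _]; lra.
pose ball (b : X * nat * R) := [set y | p b.1.2 (y - b.1.1) < b.2].
(* Having the premise [0 < b.2] under the existential lets [choice] give a function on all
   triples. *)
have step' (n : nat) (b : X * nat * R) : exists b' : X * nat * R, 0 < b.2 ->
    [/\ (n <= b'.1.2)%N, 0 < b'.2, b'.2 <= n.+1%:R^-1 &
     [set y | p b'.1.2 (y - b'.1.1) <= b'.2] `<=` ball b `&` O n].
  have [b0|b0] := ltP 0 b.2; last by exists b; rewrite ltNge b0.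
  have [||x [j [e xje]]] := step n (ball b).
  - exact: open_seminorm_ball.
  - by exists b.1.1; rewrite /ball/= subrr seminorm0.
  by exists (x, j, e).
have [f fP] := choice (fun nb : nat * (X * nat * R) => step' nb.1 nb.2).
move=> V V0 Vo.
have [x0 [j0 [e0 [_ e00 _ V0P]]]] := step 0%N V Vo V0.
pose b := fix b n := if n is m.+1 then f (m, b m) else (x0, j0, e0).
have b0 n : 0 < (b n).2.
  by elim: n => [//|n IHn] /=; have [] := fP (n, b n) IHn.
have bP n : [/\ (n <= (b n.+1).1.2)%N, 0 < (b n.+1).2, (b n.+1).2 <= n.+1%:R^-1 &
     [set y | p (b n.+1).1.2 (y - (b n.+1).1.1) <= (b n.+1).2] `<=` ball (b n) `&` O n].
  exact: (fP (n, b n) (b0 n)).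
have bS n y : p (b n.+1).1.2 (y - (b n.+1).1.1) <= (b n.+1).2 -> ball (b n) y /\ O n y.
  by have [_ _ _] := bP n; apply.
have bmono m n y : (m <= n)%N -> ball (b n) y -> ball (b m) y.
  move=> /subnK <-; elim: (n - m)%N => [//|k IHk]; rewrite addSn => by_.
  by apply: IHk; apply: (proj1 (bS _ _ _)); exact: ltW.
have bcenter n : ball (b n) (b n).1.1 by rewrite /ball/= subrr seminorm0.
have bin m n : (m <= n)%N -> p (b m).1.2 ((b n).1.1 - (b m).1.1) < (b m).2.
  by move=> mn; exact: (bmono _ _ _ mn (bcenter n)).
have [l ul] : exists l : X, (fun n => (b n).1.1) @ \oo --> l.
  apply: (frechet_complete pP) => j e e_gt0.
  (* The ball of index [N.+1] contains all later centres, has radius below [e / 2], and its seminorm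
     dominates [p j]. *)
  pose N := maxn j (Num.truncn (2 / e)).+1.
  have Ne : N.+1%:R^-1 < e / 2.
    rewrite -[e / 2]invrK ltf_pV2 ?posrE ?invr_gt0 ?divr_gt0// invf_div.
    by rewrite (lt_le_trans (truncnS_gt _))// ler_nat ltnW// ltnS leq_maxr.
  exists N.+1 => m n Nm Nn; have [Nj _ bN _] := bP N.
  have jj : (j <= (b N.+1).1.2)%N by rewrite (leq_trans _ Nj)// leq_maxl.
  rewrite (le_lt_trans (seminorm_leq _ jj))//.
  rewrite (le_lt_trans (seminorm_tri _ (b N.+1).1.1 _ _))//.
  rewrite [X in _ + X]seminormB; have := bin _ _ Nm; have := bin _ _ Nn.
  by move: (le_lt_trans bN Ne); lra.
have lb n : p (b n).1.2 (l - (b n).1.1) <= (b n).2.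
  apply/ler_addgt0Pr => e e_gt0.
  have /ul := nbhs_seminorm_ball (b n).1.2 l e_gt0.
  move=> -[N _ /(_ (maxn N n) (leq_maxl _ _)) /= lN].
  rewrite (le_trans (seminorm_tri _ (b (maxn N n)).1.1 _ _))//.
  rewrite [X in X + _]seminormB addrC lerD//; last exact: ltW.
  by rewrite ltW// bin// leq_maxr.
exists l; split; first by have [] := V0P _ (lb 0%N).
by move=> n _; exact: (proj2 (bS _ _ (lb n.+1))).
Qed.

(** * Operators depending on a compact parameter *)

Section CompactFamily.
Variables (K : set R) (T : R -> {linear X -> X}).
Hypothesis K_compact : compact K.
Hypothesis T_cont : forall l, K l -> continuous (T l).
Hypothesis T_within : forall x, {within K, continuous (fun l => T l x)}.

Lemma near_within_param x l k (e : R) : K l -> 0 < e ->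
  \forall l' \near l, K l' -> p k (T l' x - T l x) < e.
Proof.
move=> Kl e0; have /subspace_continuousP/(_ l Kl) := @T_within x.
by move=> /(_ _ (nbhs_seminorm_ball k (T l x) e0)).
Qed.

(** Continuity in [l] gives local bounds; compactness, applied along the filter [\oo] of candidate
    bounds, makes them uniform. *)
Lemma pointwise_bounded x k :
  exists N : nat, forall l, K l -> p k (T l x) <= N%:R.
Proof.
have /compact_near_coveringP cov := K_compact.
have [] := cov nat \oo (fun N l => K l -> p k (T l x) <= N%:R) _.
  move=> l Kl; exists ([set l' | K l' -> p k (T l' x - T l x) < 1],
                       [set N | p k (T l x) + 1 <= N%:R]) => /=.
    split; first exact: near_within_param.
    exact: nbhs_infty_ger.
  move=> [l' N] [/= l'l NT] Kl'; apply: le_trans NT.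
  have := seminorm_tri k (T l x) (T l' x) 0; rewrite !subr0.
  by have := l'l Kl'; lra.
move=> N _ /(_ N (leqnn N)) KN; exists N => l Kl; exact: KN.
Qed.

(** Banach-Steinhaus: by Baire and pointwise boundedness, some [N] bounds the family on a nonempty
    open set. Differences of its points give the bound [N + N] on a ball around 0, which is then
    shrunk. *)
Lemma equicontinuous_family k (e : R) : 0 < e -> exists j, exists2 d : R,
  0 < d & forall l x, K l -> p j x < d -> p k (T l x) < e.
Proof.
move=> e0.
pose O (N : nat) := [set x | exists2 l, K l & N%:R < p k (T l x)].
have Oo N : open (O N).
  rewrite openE => x [l Kl lN].
  have e'0 : 0 < p k (T l x) - N%:R by rewrite subr_gt0.
  have : nbhs x (T l @^-1` [set y | p k (y - T l x) < p k (T l x) - N%:R]).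
    exact/T_cont/nbhs_seminorm_ball.
  apply: filterS => y /= yl; exists l => //.
  have := seminorm_tri k (T l y) (T l x) 0; rewrite !subr0 (seminormB _ (T l x)).
  by move: yl; lra.
have [N nd] : exists N, ~ dense (O N).
  apply: contrapT => /forallNP Od.
  have Odd n : open (O n) /\ dense (O n) by split=> //; exact: contrapT.
  have [x [_ xO]] := frechet_baire Odd (ex_intro _ (0 : X) I) openT.
  have [N NP] := pointwise_bounded x k.
  by have [l Kl] := xO N I; rewrite ltNge NP.
have [V [[x Vx] [Vo VO]]] : exists V, V !=set0 /\ open V /\ ~ (V `&` O N !=set0).
  apply: contrapT => h; apply: nd => V V0 Vo; apply: contrapT => h'.
  by apply: h; exists V.
have [j [r r0 rV]] := open_seminorm_ballP Vo Vx.
have VN y l : K l -> V y -> p k (T l y) <= N%:R.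
  by move=> Kl Vy; rewrite leNgt; apply/negP => h; apply: VO; exists y; split=> //; exists l.
(* [M] exceeds [(N + N) / e]; the integer multiple [y *+ M] makes sense for both kinds of
   scalars. *)
pose M := (Num.truncn ((N%:R + N%:R) / e)).+1.
have M0 : 0 < M%:R :> R by rewrite ltr0n.
exists j, (r / M%:R) => [|l y Kl yr]; first exact: divr_gt0.
have yM : p j (y *+ M) < r by rewrite seminormMn mulrC -ltr_pdivlMr.
have : p k (T l (y *+ M)) <= N%:R + N%:R.
  have -> : y *+ M = (y *+ M + x) - x by rewrite addrK.
  rewrite linearB (le_trans (seminorm_tri _ 0 _ _))// sub0r seminormN subr0.
  by rewrite lerD// VN//; apply: rV => /=; rewrite ?addrK// subrr seminorm0.
rewrite linearMn seminormMn => MT; rewrite -(ltr_pM2l M0) (le_lt_trans MT)//.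
by rewrite -ltr_pdivrMr// truncnS_gt.
Qed.

(** By induction on [m]: equicontinuity controls the change of vector under [T l'], and continuity
    of the family at the fixed vector [iter m (T l) x] controls the change of parameter. *)
Lemma iter_jointly_continuous m l x U : K l -> nbhs (iter m (T l) x) U ->
  exists A B, [/\ nbhs l A, nbhs x B &
    forall l' x', A l' -> K l' -> B x' -> U (iter m (T l') x')].
Proof.
move=> Kl; elim: m U => [|m IHm] U.
  by move=> xU; exists setT, U; split => //; exact: filterT.
move=> /(frechet_topology pP) [k [e e0 eU]]; rewrite iterS in eU.
have e20 : 0 < e / 2 by rewrite divr_gt0.
have [j [d d0 dP]] := equicontinuous_family k e20.
set y := iter m (T l) x in eU.
have [A [B [lA xB ABP]]] := IHm _ (nbhs_seminorm_ball j y d0).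
exists (A `&` [set l' | K l' -> p k (T l' y - T l y) < e / 2]), B; split => //.
  by apply: filterI => //; exact: near_within_param.
move=> l' x' [Al' ll'] Kl' Bx'; apply: eU => /=.
rewrite (le_lt_trans (seminorm_tri _ (T l' y) _ _))// -linearB.
have := dP _ _ Kl' (ABP _ _ Al' Kl' Bx'); have := ll' Kl'; lra.
Qed.

(** * Vectors with frequent visits: openness *)

(** Listing some visiting times, rather than counting all of them, leaves finitely many open
    conditions. *)
Definition visits (f : X -> X) (U : set X) (delta : R) x (n : nat) :=
  exists q : seq nat, [/\ uniq q,
    forall m, m \in q -> (m <= n)%N /\ U (iter m f x) &
    delta * n.+1%:R <= (size q)%:R].

Definition visiting (U : set X) (delta : R) (N : nat) : set X :=
  [set x | forall l, K l -> exists2 n, (N <= n)%N & visits (T l) U delta x n].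

(** The listed visits persist near [(l, x)] with the same [n]; compactness of [K] yields one
    neighbourhood of [x] valid for all [l]. *)
Lemma open_visiting U delta N : open U -> open (visiting U delta N).
Proof.
move=> Uo; rewrite openE => x xV.
have /compact_near_coveringP cov := K_compact.
have : \forall x' \near x, K `<=`
    (fun l => K l -> exists2 n, (N <= n)%N & visits (T l) U delta x' n).
  apply: cov => l Kl; have [n Nn [q [uq qU qn]]] := xV l Kl.
  have [A [B [lA xB AB]]] : exists A B, [/\ nbhs l A, nbhs x B &
      forall l' x' m, A l' -> K l' -> B x' -> m \in q -> U (iter m (T l') x')].
    elim: q qU {uq qn} => [|m q IHq] qU.
      by exists setT, setT; split => //; exact: filterT.
    have [|A [B [lA xB AB]]] := IHq.
      by move=> m' m'q; apply: qU; rewrite inE m'q orbT.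
    have [A' [B' [lA' xB' AB']]] := iter_jointly_continuous Kl
      (open_nbhs_nbhs (conj Uo (proj2 (qU m (mem_head _ _))))).
    exists (A `&` A'), (B `&` B'); split; [exact: filterI|exact: filterI|].
    move=> l' x' m' [? ?] ? [? ?]; rewrite inE => /predU1P[->|m'q].
      exact: AB'.
    exact: AB.
  exists (A, B) => // -[l' x'] [/= Al' Bx'] Kl'; exists n => //.
  exists q; split => // m mq; split; last exact: AB.
  by have [] := qU m mq.
by apply: filterS => x' h l Kl; exact: h.
Qed.

End CompactFamily.

(** * Vectors with frequent visits: density *)

Lemma iter_linearD (f : {linear X -> X}) m x y :
  iter m f (x + y) = iter m f x + iter m f y.
Proof. by elim: m => [//|m IHm]; rewrite !iterS IHm linearD. Qed.

Lemma iter_linear_sum (f : {linear X -> X}) m (q : seq nat) (F : nat -> X) :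
  iter m f (\sum_(n <- q) F n) = \sum_(n <- q) iter m f (F n).
Proof.
elim: m => [//|m IHm]; rewrite iterS IHm linear_sum.
by apply: eq_bigr => n _; rewrite iterS.
Qed.

Lemma unif_uncond_cvg_seq (I : Type) (D : set I) (u : I -> nat -> X) (e : R) :
  unif_uncond_cvg p D u -> 0 < e -> exists N0 : nat, forall i q, D i ->
    uniq q -> (forall n, n \in q -> (N0 <= n)%N) ->
    Fnorm p (\sum_(n <- q) u i n) < e.
Proof.
move=> uD e0; have [N0 N0P] := uD e e0; exists N0 => i q Di uq qN.
have -> : \sum_(n <- q) u i n = \sum_(n <- [fset n in q]%fset) u i n.
  apply: perm_big; rewrite uniq_perm ?fset_uniq// => n.
  by rewrite inE.
by apply: N0P => // n; rewrite inE => /qN.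
Qed.

(** At time [m], the first term approximates [x], the earlier indices fall under (i) and the later
    ones under (ii). *)
Lemma big_seq_split_ltn (q : seq nat) (G : nat -> X) m : m \in q -> uniq q ->
  \sum_(k <- q) G k =
  G m + (\sum_(k <- q | (k < m)%N) G k + \sum_(k <- q | (m < k)%N) G k).
Proof.
move=> mq uq; rewrite (bigD1_seq m)//= (bigID (fun k => (k < m)%N))/=.
congr (_ + (_ + _)); apply: eq_bigl => k.
  by case: ltngtP.
by case: ltngtP.
Qed.

Lemma dense_visiting (a b : R) (T : R -> {linear X -> X}) (X0 : set X)
    (S : nat -> R -> X -> X) (U : set X) : dense X0 ->
  (forall x, X0 x ->
    [/\ backward_cvg p T `[a, b] S x, forward_cvg p T `[a, b] S x,
        approx_right_inverse p T `[a, b] S x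
      & orbit_unif_cvg0 p T `[a, b] x]) ->
  open U -> U !=set0 ->
  exists2 delta : R, 0 < delta &
    forall N, dense (visiting `[a, b] T U delta N).
Proof.
move=> X0_dense SP Uo U0.
have [ba|ab] := ltP b a.
  exists 1 => // N V [y Vy] Vo; exists y; split => // l.
  by rewrite /= in_itv/= => /andP[al lb]; move: (le_trans al lb); rewrite leNgt ba.
have [x [Ux X0x]] := X0_dense U U0 Uo.
have [e e0 eU] := open_Fnorm_ballP Uo Ux.
(* One quarter for each part of [iter m (T l) z - x]: the orbit of [y], the term of index [m], the
   earlier terms and the later ones. *)
have e'0 : 0 < e / 4 by rewrite divr_gt0.
have [bx fx ax _] := SP x X0x.
have [M1 M1P] := unif_uncond_cvg_seq bx e'0.
have [M2 M2P] := unif_uncond_cvg_seq fx e'0.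
have [d [d0 d_mono dP d_div]] := ax _ e'0.
have [M [M0 M1M M2M]] : exists M, [/\ 0 < M, M1 <= M & M2 <= M]%N.
  by exists (M1 + M2).+1; split; lia.
(* The factor 2 leaves room for [c ^ t] multiples of [M] in [[c ^ t, c ^ t.+1)]. *)
pose c := (2 * M)%N.
have c1 : (1 < c)%N by rewrite /c mul2n -addnn (leq_add M0 M0).
have c0 : (0 < c)%N by apply: ltnW.
exists c%:R^-1 => [|N V V0 Vo]; first by rewrite invr_gt0 ltr0n.
have [y [Vy X0y]] := X0_dense V V0 Vo.
have [eta eta0 etaV] := open_Fnorm_ballP Vo Vy.
have [_ _ _ /(_ _ e'0) [N1 _ N1P]] := SP y X0y.
(* Condition (ii) with [m = 0] will make [z - y] small. *)
have [N2 N2P] := unif_uncond_cvg_seq fx eta0.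
have [t0 [t0_gt0 Nt0 N1t0 N2t0]] :
    exists t0, [/\ 0 < t0, N <= t0, N1 <= t0 & N2 <= t0]%N.
  by exists (N + N1 + N2).+1; clear; split; lia.
(* As [d] decreases, its value at the right end of a block is at most [d m] for every positive [m]
   in the block. *)
have [|nu [t1 [nu_ab nu_mono nuP]]] :=
    @interval_cover R (fun t => d (c ^ t.+1)%N) a b t0 _ (d_div _ c0) ab.
  by move=> t; rewrite d0// expn_gt0 c0.
pose mu n := nu (trunc_log c n).
have mu_mono m n : (m <= n)%N -> mu m <= mu n.
  by move=> mn; apply/nu_mono/leq_trunc_log.
have mu_ab n : mu n \in `[a, b] by rewrite in_itv/=; exact: nu_ab.
pose A := [seq n <- index_iota (c ^ t0) (c ^ t1) | (M %| n)%N].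
have A_uniq : uniq A by rewrite filter_uniq// iota_uniq.
have A_ge n : n \in A -> (t0 < n)%N.
  rewrite mem_filter mem_index_iota => /and3P[_ + _].
  by apply: leq_trans; rewrite ltn_expl.
have A_sep m k : m \in A -> k \in A -> (k < m)%N -> (M <= m - k)%N.
  rewrite !mem_filter => /andP[Mm _] /andP[Mk _] km.
  by rewrite dvdn_leq ?subn_gt0// dvdn_sub.
pose F n := S n (mu n) x.
pose z := y + \sum_(n <- A) F n.
exists z; split.
  apply: etaV; rewrite /z addrC addKr.
  apply: (N2P (0%N, mu, a) A) => //; last first.
    by move=> n /A_ge /ltnW; apply: leq_trans.
  split; [exact: mu_ab|by move=> n; exact: mu_mono| |].
    by rewrite /= in_itv/= lexx.
  by have /andP[] := nu_ab (trunc_log c 0).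
move=> l /= lab; have := lab; rewrite in_itv/= => /nuP[t [/andP[t0t tt1] l_nu nu_l]].
have key m : m \in A -> (c ^ t <= m < c ^ t.+1)%N -> U (iter m (T l) z).
  move=> mA mt; apply: eU.
  have mu_m : mu m = nu t by rewrite /mu (trunc_log_eq c1 mt).
  have m0 : (0 < m)%N by rewrite (leq_trans _ (A_ge _ mA)).
  have -> : iter m (T l) z - x =
      iter m (T l) y + (iter m (T l) (F m) - x) +
      (\sum_(k <- A | (k < m)%N) iter m (T l) (F k) +
       \sum_(k <- A | (m < k)%N) iter m (T l) (F k)).
    rewrite iter_linearD iter_linear_sum (big_seq_split_ltn _ mA A_uniq).
    by rewrite -!addrA; congr (_ + (_ + _)); rewrite [RHS]addrC addrA.
  have ly : Fnorm p (iter m (T l) y) < e / 4.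
    by apply: N1P => //=; rewrite (leq_trans N1t0)// ltnW// A_ge.
  have lm : Fnorm p (iter m (T l) (F m) - x) <= e / 4.
    apply: dP => //=.
    rewrite mu_m subr_ge0 l_nu (le_trans nu_l)//.
    have /andP[_ /ltnW /subnK <-] := mt.
    elim: (_ - m)%N => [//|k IHk]; rewrite addSn (le_trans _ IHk)//.
    by apply: d_mono; rewrite addn_gt0 m0 orbT.
  (* The index [n] of conditions (i) and (ii) is the distance from [k] to [m], which
     is at least [M] as both are multiples of [M]. *)
  have lB : Fnorm p (\sum_(k <- A | (k < m)%N) iter m (T l) (F k)) < e / 4.
    have -> : \sum_(k <- A | (k < m)%N) iter m (T l) (F k) =
        \sum_(n <- [seq (m - k)%N | k <- [seq k <- A | (k < m)%N]])
          if (n <= m)%N then iter m (T l) (S (m - n)%N (mu (m - n)%N) x) else 0.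
      rewrite big_map big_filter; apply: eq_bigr => k km.
      by rewrite leq_subr subKn// ltnW.
    (* Read backwards from [m], the nondecreasing [mu] becomes nonincreasing, as (i) requires. *)
    apply: (M1P (m, fun n => mu (m - n)%N, l)).
    - split => //; first by move=> n _; exact: mu_ab.
      by move=> n _; apply/mu_mono/leq_sub2l.
    - rewrite map_inj_in_uniq ?filter_uniq ?iota_uniq// => k k'.
      by rewrite !mem_filter => /andP[km _] /andP[k'm _]; clear -km k'm; lia.
    move=> n /mapP[k]; rewrite mem_filter => /andP[km kA] ->.
    exact: leq_trans M1M (A_sep _ _ mA kA km).
  have lG : Fnorm p (\sum_(k <- A | (m < k)%N) iter m (T l) (F k)) < e / 4.
    have -> : \sum_(k <- A | (m < k)%N) iter m (T l) (F k) =
        \sum_(n <- [seq (k - m)%N | k <- [seq k <- A | (m < k)%N]])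
          iter m (T l) (S (m + n)%N (mu (m + n)%N) x).
      rewrite big_map big_filter; apply: eq_bigr => k km.
      by rewrite subnKC// ltnW.
    apply: (M2P (m, fun n => mu (m + n)%N, l)).
    - split => //; first by move=> n; exact: mu_ab.
        by move=> n; apply/mu_mono; rewrite leq_add2l.
      (* The requirement that [l] be at most the first parameter is [l <= nu t], from the choice of
         [t]. *)
      by rewrite addn0 mu_m.
    - rewrite map_inj_in_uniq ?filter_uniq ?iota_uniq// => k k'.
      by rewrite !mem_filter => /andP[km _] /andP[k'm _]; clear -km k'm; lia.
    move=> n /mapP[k]; rewrite mem_filter => /andP[km kA] ->.
    exact: leq_trans M2M (A_sep _ _ kA mA km).
  apply: le_lt_trans (FnormD _ _) _; apply: le_lt_trans (lerD (FnormD _ _) (FnormD _ _)) _.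
  by lra.
(* With this [n], [n.+1 = c ^ t.+1], so [c ^ t] visits have proportion exactly [c^-1]. *)
exists (c ^ t.+1).-1.
  rewrite -ltnS prednK ?expn_gt0 ?c0// (leq_ltn_trans Nt0)//.
  by rewrite (leq_ltn_trans t0t)// ltnW// ltn_expl.
exists [seq (c ^ t + k * M)%N | k <- iota 0 (c ^ t)]; split.
- rewrite map_inj_in_uniq ?iota_uniq// => k k' _ _ /addnI /eqP.
  by rewrite eqn_pmul2r// => /eqP.
- move=> m /mapP[k]; rewrite mem_iota/= add0n => kt ->.
  have mt : (c ^ t + k * M < c ^ t.+1)%N.
    have : (k * M + M <= c ^ t * M)%N by rewrite -mulSnr leq_mul2r kt orbT.
    have : (c ^ t <= c ^ t * M)%N by rewrite leq_pmulr.
    by rewrite expnS /c; nia.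
  split; first by rewrite -ltnS prednK ?expn_gt0 ?c0.
  apply: key; last by rewrite leq_addr.
  rewrite mem_filter mem_index_iota dvdn_add//=.
  + rewrite (leq_trans _ (leq_addr _ _)) ?leq_exp2l//=.
    by rewrite (leq_trans mt)// leq_exp2l.
  (* [0 < t0] gives [0 < t], hence [M] divides [c ^ t]. *)
  + have -> : t = t.-1.+1 by rewrite prednK// (leq_trans _ t0t).
    by rewrite expnS /c -mulnA mulnCA dvdn_mulr.
  + exact: dvdn_mull.
- rewrite size_map size_iota prednK ?expn_gt0 ?c0// expnS natrM mulrA.
  by rewrite mulVf ?mul1r// pnatr_eq0 -lt0n.
Qed.

(** * Countably many open sets to visit *)

(** Balls with centres in a countable dense set and inverse integers as radii. Inclusion of some
    [B i] in [U] suffices, since visits to [B i] are visits to [U]. *)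
Lemma frechet_second_countable : separable X ->
  exists B : nat * nat * nat -> set X,
    (forall i, open (B i) /\ B i !=set0) /\
    forall U, open U -> U !=set0 -> exists i, B i `<=` U.
Proof.
move=> [D [/countable_injP[f f_inj] D_dense]].
have enumD n : exists x : X, forall y, D y -> f y = n -> x = y.
  have [[x Dx fx]|nD] := pselect (exists2 x, D x & f x = n).
    exists x => y Dy fy; apply: f_inj; rewrite ?inE//.
    by rewrite fx fy.
  by exists 0 => y Dy fy; case: nD; exists y.
have [g gP] := choice enumD.
exists (fun i => [set y | p i.1.2 (y - g i.1.1) < i.2.+1%:R^-1]); split.
  move=> i; split; first exact: open_seminorm_ball.
  by exists (g i.1.1); rewrite /= subrr seminorm0 invr_gt0.
move=> U Uo [x Ux]; have [j [e e0 eU]] := open_seminorm_ballP Uo Ux.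
have e20 : 0 < e / 2 by rewrite divr_gt0.
have [y [/= yx Dy]] : [set y | p j (y - x) < e / 2] `&` D !=set0.
  apply: D_dense; last exact: open_seminorm_ball.
  by exists x; rewrite /= subrr seminorm0.
exists (f y, j, Num.truncn (2 / e)) => z /=; rewrite (gP (f y) y)// => zy.
apply: eU; rewrite /= (le_lt_trans (seminorm_tri _ y _ _))//.
have : (Num.truncn (2 / e)).+1%:R^-1 < e / 2.
  by rewrite -[e / 2]invrK ltf_pV2 ?posrE ?invr_gt0// invf_div truncnS_gt.
by move=> /(lt_trans zy); lra.
Qed.

End FrechetSpace.

(** * From visits to upper density *)

(** The limit superior is an infimum of suprema over neighbourhoods of infinity, each of which
    contains some [n] with proportion at least [delta]. *)
Lemma upper_density_gt0 (R : realType) (A : set nat) (delta : R) : 0 < delta ->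
  (forall N, exists2 n, (N <= n)%N & exists q : seq nat, [/\ uniq q,
    forall m, m \in q -> (m <= n)%N /\ A m &
    delta * n.+1%:R <= (size q)%:R]) ->
  (0 < upper_density R A)%E.
Proof.
move=> delta0 AP; apply: (@lt_le_trans _ _ delta%:E); first by rewrite lte_fin.
apply: le_ereal_inf_tmp => _ [V [N _ NV] <-].
have [n Nn [q [uq qA qn]]] := AP N.
apply: le_trans (ereal_sup_ubound (imageP _ (NV n Nn))).
rewrite lee_fin ler_pdivlMr ?ltr0n// (le_trans qn)// ler_nat uniq_leq_size//.
have fin : finite_set (A `&` `I_n.+1) by apply: finite_setIr; exact: finite_II.
by move=> m /qA[mn Am]; rewrite in_fset_set// inE.
Qed.

(** * Exhausting an interval by countably many compact ones *)

Section Exhaustion.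
Variables (R : realType) (L : set R).

(* [None] is only meant for an end point that belongs to [L] (otherwise [inf] and
   [sup] may even be junk values); the rational points of [L] need not reach it. *)
Definition lower_end (o : option rat) : R :=
  if o is Some q then ratr q else inf L.
Definition upper_end (o : option rat) : R :=
  if o is Some q then ratr q else sup L.

(** Either [L] has a point below [l], and a rational between them lies in [L] by convexity, or [l]
    is the least element of [L], hence [inf L]. *)
Lemma lower_endP l : is_interval L -> L l -> exists o, lower_end o <= l /\ L (lower_end o).
Proof.
move=> Li Ll; have [[y Ly yl]|nL] := pselect (exists2 y, L y & y < l).
  have [q] := rat_in_itvoo yl; rewrite in_itv/= => /andP[yq ql].
  exists (Some q); split; first exact: ltW.
  by apply: (Li y l) => //; rewrite !ltW.
have lL : lbound L l.
  by move=> y Ly; rewrite leNgt; apply/negP => yl; apply: nL; exists y.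
suff lE : inf L = l by exists None; rewrite /= lE.
apply/eqP; rewrite eq_le ge_inf//; last by exists l.
by rewrite lb_le_inf//; exists l.
Qed.

Lemma upper_endP l : is_interval L -> L l -> exists o, l <= upper_end o /\ L (upper_end o).
Proof.
move=> Li Ll; have [[y Ly ly]|nL] := pselect (exists2 y, L y & l < y).
  have [q] := rat_in_itvoo ly; rewrite in_itv/= => /andP[lq qy].
  exists (Some q); split; first exact: ltW.
  by apply: (Li l y) => //; rewrite !ltW.
have lL : ubound L l.
  by move=> y Ly; rewrite leNgt; apply/negP => ly; apply: nL; exists y.
suff lE : sup L = l by exists None; rewrite /= lE.
apply/eqP; rewrite eq_le ge_sup//=; last by exists l.
by rewrite ub_le_sup//; exists l.
Qed.

End Exhaustion.

(** * Residuality and non-emptiness *)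

Unset Implicit Arguments.

Theorem theorem7 (R : realType) (s : scalar_kind) (X : tvsType (scalars R s))
    (p : nat -> X -> R) (Lambda : set R) (T : R -> {linear X -> X})
    (Lambda_interval : is_interval Lambda)
    (X_frechet : frechet_seminorms p)
    (X_separable : separable X)
    (T_operator : forall l, Lambda l -> continuous (T l))
    (T_family : forall x : X, {within Lambda, continuous (fun l => T l x)})
    (criterion : forall K : set R,
      is_interval K -> compact K -> K `<=` Lambda ->
      exists X0 : set X, dense X0 /\
      exists S : nat -> R -> X -> X, forall x, X0 x ->
        [/\ backward_cvg p T K S x,
            forward_cvg p T K S x,
            approx_right_inverse p T K S x
          & orbit_unif_cvg0 p T K x]) :
  residual (common_upper_freq_hypercyclic Lambda T) /\
  common_upper_freq_hypercyclic Lambda T !=set0.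
Proof.
have [B [B_open B_base]] := frechet_second_countable X_frechet X_separable.
pose K (i : option rat * option rat) : set R :=
  `[lower_end Lambda i.1, upper_end Lambda i.2]%classic.
have deltaE (i : (option rat * option rat) * (nat * nat * nat)) : exists r : R,
    K i.1 `<=` Lambda ->
    0 < r /\ forall N, dense (visiting (K i.1) T (B i.2) r N).
  have [KL|nKL] := pselect (K i.1 `<=` Lambda); last by exists 0.
  have [X0 [X0_dense [S SP]]] :=
    criterion (K i.1) (@interval_is_interval _ _) (@segment_compact _ _ _) KL.
  have [Bo B0] := B_open i.2.
  by have [r r0 rP] := dense_visiting X_frechet X0_dense SP Bo B0; exists r.
have [delta deltaP] := choice deltaE.
(* Integers coding nothing, and intervals not contained in [Lambda], contribute the whole space,
   which is open and dense. *)
pose W n : set X :=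
  if @unpickle ((option rat * option rat) * (nat * nat * nat) * nat)%type n
    is Some (i, N) then
    if `[< K i.1 `<=` Lambda >] then visiting (K i.1) T (B i.2) (delta i) N
    else setT
  else setT.
have WP n : open (W n) /\ dense (W n).
  have setT_dense : dense [set: X] by move=> V [x Vx] _; exists x.
  have setTP : open [set: X] /\ dense [set: X] by split; [exact: openT|].
  rewrite /W; case: unpickle => [[i N]|//]; case: asboolP => // KL.
  split; last by have [_] := deltaP i KL; apply.
  apply: (open_visiting X_frechet); last by have [] := B_open i.2.
  - exact: segment_compact.
  - by move=> l /KL; exact: T_operator.
  - by move=> x; exact: continuous_subspaceW KL (T_family x).
have WA : \bigcap_n W n `<=` common_upper_freq_hypercyclic Lambda T.
  move=> x Wx l Ll U Uo U0; have [j BU] := B_base U Uo U0.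
  have [lo [lol Llo]] := lower_endP Lambda_interval Ll.
  have [hi [lhi Lhi]] := upper_endP Lambda_interval Ll.
  have KL : K (lo, hi) `<=` Lambda.
    move=> l'; rewrite /K/= in_itv/= => l'o.
    exact: (Lambda_interval _ _ Llo Lhi).
  have [delta0 _] := deltaP ((lo, hi), j) KL.
  apply: upper_density_gt0 delta0 _ => N.
  have := Wx (pickle (((lo, hi), j), N)) I.
  rewrite /W pickleK; case: asboolP => [_ /(_ l)|//].
  case => [|n Nn [q [uq qB qn]]]; first by rewrite /K /= in_itv/= lol lhi.
  by exists n => //; exists q; split => // m /qB[? ?]; split => //; exact: BU.
split; first by exists W.
have [x [_ Wx]] := frechet_baire X_frechet WP (ex_intro _ (0 : X) I) openT.
by exists x; exact: WA.
Qed.
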